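(* Let $\kappa$ be a finite field of characteristic $p\neq 2$ and fix $c,d\in\kappa^\times$. For a closed point $u_0 \in \mathbf{A}^1_\kappa$, let $\kappa_0 = \kappa(u_0)$ be its residue field, also write $u_0 \in \kappa_0$ for the image of $u$ under $\kappa[u]\to\kappa_0$, and define $$\pi_1 = c^{1/p}(T^2+u_0)^2 + d^{1/p}u_0^{1/p}, \qquad \pi_2 = 1 + 4\pi_1 \quad \in \kappa_0[T].$$ Then there exist infinitely many closed points $u_0 \in \mathbf{A}^1_\kappa$ such that both $\pi_1$ and $\pi_2$ are irreducible in $\kappa_0[T]$.
   Context: Here $x^{1/p}$ denotes the unique $p$th root in the (perfect) finite field. *)

(* Defs.v *)
From HB Require Import structures.
From mathcomp Require Import all_boot all_order all_algebra all_field.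
Set Implicit Arguments.
Unset Strict Implicit.
Unset Printing Implicit Defensive.
Import GRing.Theory.
Local Open Scope ring_scope.

(* The p-th root in a finite field F of characteristic p: the (unique, as
   Frobenius is bijective on a finite field) y with y ^+ p = x.            *)
Definition proot (F : finFieldType) (p : nat) (x : F) : F :=
  odflt 0 [pick y : F | y ^+ p == x].

(* Closed points u0 of A^1_kappa are monic irreducible f in kappa[u];
   the residue field is kappa0 = kappa[u]/(f) = {poly %/ f with hf},
   and u0 in kappa0 is the class 'qX of u. *)
Definition pi1 (F : finFieldType) (p : nat) (c d : F) (f : {poly F})
  (hf : monic_irreducible_poly f) : {poly {poly %/ f with hf}} :=
  let u0 : {poly %/ f with hf} := 'qX in
  ((proot p c)%:A)%:P * ('X ^+ 2 + u0%:P) ^+ 2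
  + ((proot p d)%:A * proot p u0)%:P.

Definition pi2 (F : finFieldType) (p : nat) (c d : F) (f : {poly F})
  (hf : monic_irreducible_poly f) : {poly {poly %/ f with hf}} :=
  1 + 4%:R *: pi1 p c d hf.

(* Main.v *)
Require Import Defs.
From HB Require Import structures.
From mathcomp Require Import all_boot all_order all_algebra all_field.
From mathcomp Require Import ring zify.
Set Implicit Arguments.
Unset Strict Implicit.
Unset Printing Implicit Defensive.
Import GRing.Theory Num.Theory Order.TTheory.
Local Open Scope ring_scope.

(** Write w = u_0^(1/p), g = c^(1/p), e = (d/c)^(1/p).  A quartic
    a (T^2 + b)^2 + r over a field of odd characteristic is irreducible as soon
    as -r/a and b^2 + r/a are nonsquares, so it suffices that -e w,
    e (a - w) with a = -1/(4 d^(1/p)), f_3(w) = w^(2p) + e w and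
    f_4(w) = f_3(w) + 1/(4g) are nonsquares.  Passing to a finite extension K of
    kappa over which f_3 and f_4 split and e is a square, each condition says
    that prod_(b in B) (b - w) is a nonsquare for some B included in K, and, if
    P is the minimal polynomial of w over K, taking norms to K turns it into
    prod_(b in B) chi(P(b)) = -1 with chi the quadratic character of K.

    Thus one needs primes P of K[t] of large degree at which finitely many
    independent quadratic characters psi_i take the value -1.  Put
    psi_S = prod_(i in S) psi_i and L_S(X) = sum_m psi_S(m) X^(deg m), which is
    a polynomial for S nonempty, while L_set0 = 1 / (1 - q X).  If psi_i(P) = 1
    for some i, the Euler factors of L_S and of L_(S + {i}) at P agree, so P
    disappears from the quotient of the products of L_S over S even and over S
    odd.  If only finitely many P were left, this would give an identity
    R_1 (1 - q X) prod_(S odd) L_S = R_2 prod_(S even, S <> set0) L_S with R_1,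
    R_2 products of factors 1 - s X^k with s in {0, 1, -1}; at X = 1/q the left
    side vanishes and the right side does not, since L_S(1/q) <> 0. *)

(** * Euler products over K[t] *)

Lemma monic_irreducible_dvdM (K : fieldType) (P a b : {poly K}) :
  monic_irreducible_poly P -> (P %| a * b) = (P %| a) || (P %| b).
Proof.
move=> [irrP _]; apply/idP/orP => [dvdPab|[]]; last 2 first.
- exact: dvdp_mulr.
- exact: dvdp_mull.
have [?|ndv] := boolP (P %| a); [by left|right].
by move: dvdPab; rewrite Gauss_dvdpr // irreducible_poly_coprime.
Qed.

Lemma monic_irreducible_dvd (K : fieldType) (P Q : {poly K}) :
  monic_irreducible_poly P -> monic_irreducible_poly Q -> Q %| P -> P = Q.
Proof.
move=> [irrP mP] [[sQ _] mQ] dQP; apply/eqP; rewrite -eqp_monic // eqp_sym.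
by apply: irrP => //; rewrite gtn_eqF.
Qed.

Section EulerProduct.
Variables (K : finFieldType) (psi : {poly K} -> rat).
Hypotheses (psiM : {morph psi : x y / x * y}) (psi1 : psi 1 = 1).

(** The [n]-th coefficient of the L-series of [psi] stripped of its Euler factors at the primes in
    [A]. *)
Definition sieve_sum (A : seq {poly K}) (n : nat) : rat :=
  \sum_(v : {poly_n.+1 K} | [&& polyn v \is monic, size (polyn v) == n.+1 &
      all (fun P => ~~ (P %| polyn v)) A]) psi (polyn v).

(** The monic multiples of [P] of degree [n] are the [P * v] with [v] monic of degree [n - deg P].
    As [P] is not in [A], the primes of [A] dividing [P * v] are those dividing [v]. *)
Lemma sieve_sum_cons (P : {poly K}) (A : seq {poly K}) (n : nat) :
  monic_irreducible_poly P ->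
  {in A, forall Q, monic_irreducible_poly Q} -> P \notin A ->
  sieve_sum A n = sieve_sum (P :: A) n +
    (if ((size P).-1 <= n)%N then psi P * sieve_sum A (n - (size P).-1)%N else 0).
Proof.
move=> miP miA PA; have [[sP _] mP] := miP.
have P0 : P != 0 by exact: monic_neq0.
set d := (size P).-1; have szP : size P = d.+1 by rewrite /d prednK // (ltn_trans _ sP).
rewrite /sieve_sum (bigID (fun v => P %| polyn v)) /= addrC; congr (_ + _).
  by apply: eq_bigl => v; rewrite -!andbA; do 2 congr (_ && _); rewrite andbC.
case: leqP => [ledn|ltnd]; last first.
  rewrite big_pred0 // => v; apply/negbTE/negP => /andP[/and3P[mv /eqP sv _] dv].
  by have := dvdp_leq (monic_neq0 mv) dv; rewrite sv szP ltnS leqNgt ltnd.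
have szPM (v : {poly K}) : v \is monic -> size (P * v)%R = (size v + d)%N.
  move=> mv; rewrite size_proper_mul;
    last by rewrite (monicP mP) (monicP mv) mulr1 oner_eq0.
  by rewrite szP /= addnC.
rewrite (reindex_onto (fun v : {poly_(n - d).+1 K} => npolyp n.+1 (P * polyn v))
  (fun v => npolyp (n - d).+1 (polyn v %/ P))) /=; last first.
  move=> v /andP[/and3P[mv /eqP sv _] dv]; apply/val_inj.
  have sq : (size (polyn v %/ P)%R <= (n - d).+1)%N.
    by rewrite size_divp // sv szP /= subSn.
  by rewrite /= [X in P * X]npolypK // [P * _]mulrC divpK // npolypK // sv.
have szPv (v : {poly_(n - d).+1 K}) : (size (P * polyn v)%R <= n.+1)%N.
  apply: leq_trans (size_polyMleq P (polyn v)) _; rewrite szP /=.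
  by apply: leq_trans (leq_add (leqnn d) (size_npoly v)) _; rewrite addnS subnKC.
rewrite mulr_sumr; apply: eq_big => [v|v].
  rewrite (npolypK (szPv v)) mulKp // dvdp_mulr ?dvdpp // andbT.
  have -> : npolyp (n - d).+1 (polyn v) == v.
    by apply/eqP/val_inj/npolypK/size_npoly.
  rewrite andbT monicMl //; case mv: (_ \is monic) => //=.
  rewrite szPM //; congr (_ && _); first by rewrite -[in RHS](eqn_add2r d) addSn subnK.
  apply: eq_in_all => Q QA; rewrite monic_irreducible_dvdM; last exact: miA.
  suff /negbTE-> : ~~ (Q %| P) by [].
  by apply: contra PA => /(monic_irreducible_dvd miP (miA _ QA)) ->.
move=> /andP[/andP[/and3P[_ /eqP sv _] _] _].
by rewrite npolypK ?psiM.
Qed.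

Definition primes_below (N : nat) : seq {poly K} :=
  [seq polyn v | v <- enum {poly_N K} & (polyn v \is monic) && irreducibleb (polyn v)].

Lemma mem_primes_below N P :
  reflect (monic_irreducible_poly P /\ (size P <= N)%N) (P \in primes_below N).
Proof.
apply: (iffP mapP) => [[v]|[[/irreducibleP iP mP] sP]].
  by rewrite mem_filter => /andP[/andP[mv /irreducibleP iv] _] ->; rewrite size_npoly.
by exists (npolyp N P); rewrite ?npolypK // mem_filter npolypK // mP iP mem_enum.
Qed.

Lemma primes_below_uniq N : uniq (primes_below N).
Proof.
by rewrite map_inj_uniq => [|u v]; [apply/filter_uniq/enum_uniq|apply: val_inj].
Qed.

Lemma exists_irreducible_factor (m : {poly K}) : (1 < size m)%N ->
  exists2 P, monic_irreducible_poly P & P %| m.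
Proof.
have [n] := ubnP (size m); elim: n m => // n IH m /ltnSE szm sm.
have [/irreducibleP im|] := boolP (irreducibleb m).
  have lm : lead_coef m != 0 by rewrite lead_coef_eq0 -size_poly_gt0 (ltn_trans _ sm).
  exists ((lead_coef m)^-1 *: m); last by rewrite dvdpZl ?invr_eq0.
  split; last by rewrite monicE lead_coefZ mulVf.
  split=> [|q sq]; first by rewrite size_scale // invr_eq0.
  rewrite dvdpZr ?invr_eq0 // => /im.2 => /(_ sq) eq; apply: (eqp_trans eq).
  by rewrite eqp_sym eqp_scale // invr_eq0.
rewrite /irreducibleb sm /= negb_forall => /existsP[q]; rewrite negb_imply -ltnNge.
rewrite -Pdiv.Idomain.dvdpE => /andP[dq sq].
have lqn : (size (polyn q) < n)%N.
  apply: leq_ltn_trans (size_npoly q) _.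
  by apply: leq_trans szm; rewrite prednK // (ltn_trans _ sm).
by have [P miP dP] := IH _ lqn sq; exists P => //; apply: dvdp_trans dP dq.
Qed.

(** A nonconstant polynomial of degree [n < N] has a prime factor of size at most [N], so only the
    constant 1 survives the sieve. *)
Lemma sieve_sum_primes N n : (n < N)%N ->
  sieve_sum (primes_below N) n = (n == 0)%N%:R.
Proof.
move=> ltnN; rewrite /sieve_sum; case: n ltnN => [|n] ltnN /=.
  rewrite (big_pred1 (npolyp 1 1)) => [|v]; rewrite ?npolypK ?size_poly1 //.
  apply/and3P/eqP => [[mv /eqP sv _]|->].
    apply: val_inj; rewrite /= npolypK ?size_poly1 //.
    have /size_poly1P[c _ vc] : size (polyn v) == 1%N by rewrite sv.
    by move: mv; rewrite vc monicE lead_coefC => /eqP->.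
  rewrite npolypK ?size_poly1 //; split; rewrite ?monic1 //.
  apply/allP => P /mem_primes_below[[[sP _] _] _]; rewrite dvdp1.
  by rewrite gtn_eqF.
rewrite big_pred0 // => v; apply/negbTE/negP => /and3P[mv /eqP sv /allP h].
have [|P miP dP] := @exists_irreducible_factor (polyn v); first by rewrite sv.
have /h : P \in primes_below N; last by rewrite dP.
apply/mem_primes_below; split=> //.
by apply: leq_trans ltnN; rewrite -sv dvdp_leq // monic_neq0.
Qed.
End EulerProduct.

(** * Power series truncated at [X^N] *)

Definition eqmodX (N : nat) (p q : {poly rat}) :=
  forall n, (n < N)%N -> p`_n = q`_n.

Lemma eqmodX_sym N p q : eqmodX N p q -> eqmodX N q p.
Proof. by move=> h n /h. Qed.

Lemma eqmodX_trans N q p r : eqmodX N p q -> eqmodX N q r -> eqmodX N p r.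
Proof. by move=> h1 h2 n ltnN; rewrite h1 // h2. Qed.

Lemma eqmodXM N p p' q q' :
  eqmodX N p p' -> eqmodX N q q' -> eqmodX N (p * q) (p' * q').
Proof.
move=> hp hq n ltnN; rewrite !coefM; apply: eq_bigr => i _.
rewrite hp ?hq //; first exact: leq_ltn_trans (leq_subr _ _) ltnN.
by apply: leq_ltn_trans ltnN; rewrite -ltnS.
Qed.

Lemma eqmodX_prod (I : finType) (Q : pred I) N (p q : I -> {poly rat}) :
  (forall i, Q i -> eqmodX N (p i) (q i)) ->
  eqmodX N (\prod_(i | Q i) p i) (\prod_(i | Q i) q i).
Proof. by move=> h; elim/big_ind2: _ => // *; apply: eqmodXM. Qed.

(** * L-polynomials and their Euler products *)

Section LFunction.
Variables (K : finFieldType).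
Implicit Types (psi : {poly K} -> rat) (P : {poly K}) (A : seq {poly K}).

(** The reciprocal of the usual local factor, so that Euler products stay polynomial. *)
Definition euler_factor psi P : {poly rat} := 1 - psi P *: 'X^((size P).-1).

Definition Lpoly psi N A : {poly rat} := \poly_(n < N) sieve_sum psi A n.

Lemma Lpoly_cons psi N P A : {morph psi : x y / x * y} ->
  monic_irreducible_poly P ->
  {in A, forall Q, monic_irreducible_poly Q} -> P \notin A ->
  eqmodX N (euler_factor psi P * Lpoly psi N A) (Lpoly psi N (P :: A)).
Proof.
move=> psiM miP miA PA n ltnN.
rewrite mulrBl mul1r -scalerAl coefB coefZ coefXnM !coef_poly ltnN.
rewrite (sieve_sum_cons psiM _ miP miA PA); case: ltnP => _.
  by rewrite mulr0 subr0 addr0.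
by rewrite (leq_ltn_trans (leq_subr _ _) ltnN) addrK.
Qed.

Lemma euler_product psi N : {morph psi : x y / x * y} -> psi 1 = 1 ->
  eqmodX N ((\prod_(P <- primes_below K N) euler_factor psi P) * Lpoly psi N [::]) 1.
Proof.
move=> psiM psi1.
suff h A : uniq A -> {in A, forall Q, monic_irreducible_poly Q} ->
    eqmodX N ((\prod_(P <- A) euler_factor psi P) * Lpoly psi N [::]) (Lpoly psi N A).
  apply: eqmodX_trans (h _ (primes_below_uniq _ _) _) _.
    by move=> P /mem_primes_below[].
  by move=> n ltnN; rewrite coef_poly ltnN sieve_sum_primes // coef1.
elim: A => [|P A IH] /=; first by rewrite big_nil mul1r.
move=> /andP[PA uA] miPA.
have miA : {in A, forall Q, monic_irreducible_poly Q}.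
  by move=> Q QA; apply: miPA; rewrite inE QA orbT.
rewrite big_cons -mulrA.
apply: eqmodX_trans (Lpoly_cons (N := N) psiM (miPA _ (mem_head _ _)) miA PA).
by apply: eqmodXM => //; apply: IH.
Qed.

Lemma sieve_sum1 n : sieve_sum (fun _ : {poly K} => 1) [::] n = #|K|%:R ^+ n.
Proof.
rewrite /sieve_sum -natrX -card_npoly.
have szX (v : {poly_n K}) : (size (polyn v) < size ('X^n : {poly K})%R)%N.
  by rewrite size_polyXn ltnS size_npoly.
have szXD (v : {poly_n K}) : size ('X^n + polyn v)%R = n.+1.
  by rewrite size_polyDl ?size_polyXn // ltnS size_npoly.
rewrite (reindex_onto (fun v : {poly_n K} => npolyp n.+1 ('X^n + polyn v))
   (fun v => npolyp n (polyn v - 'X^n))) /=; last first.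
  move=> v /and3P[mv /eqP sv _]; apply/val_inj; rewrite /= [X in _ + X]npolypK.
    by rewrite addrC subrK npolypK // sv.
  apply/leq_sizeP => j lenj; rewrite coefB coefXn.
  move: lenj; rewrite leq_eqVlt => /predU1P[<-|ltnj].
    by rewrite eqxx; move: mv; rewrite monicE /lead_coef sv => /eqP->; rewrite subrr.
  by rewrite gtn_eqF // subr0 nth_default // sv.
rewrite (eq_bigl predT) ?sumr_const // => v.
rewrite npolypK ?szXD // eqxx !andbT monicE lead_coefDl // lead_coefXn eqxx /=.
rewrite addrC addKr; apply/eqP/val_inj; exact/npolypK/size_npoly.
Qed.

(** Both sides are inverse modulo [X^N] to the zeta series [Z], whose coefficients count the monic
    polynomials of each degree. *)
Lemma zeta_euler_product N :
  eqmodX N (\prod_(P <- primes_below K N) euler_factor (fun=> 1) P) (1 - #|K|%:R *: 'X).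
Proof.
set E := \prod_(P <- _) _; pose Z := Lpoly (fun _ : {poly K} => 1) N [::].
have hE : eqmodX N (E * Z) 1 by apply: euler_product => // x y; rewrite mulr1.
have hZ : eqmodX N ((1 - #|K|%:R *: 'X) * Z) 1.
  move=> n ltnN; rewrite mulrBl mul1r coefB -scalerAl coefZ coefXM !coef_poly ltnN.
  case: n ltnN => [|n] ltnN /=; first by rewrite mulr0 subr0 sieve_sum1 expr0 coef1.
  by rewrite (ltnW ltnN) !sieve_sum1 exprS subrr coef1.
apply: eqmodX_trans (_ : eqmodX N (E * ((1 - #|K|%:R *: 'X) * Z)) _).
  by rewrite -{1}[E]mulr1; apply: eqmodXM => //; apply: eqmodX_sym.
rewrite mulrCA -[X in eqmodX _ _ X]mulr1; exact: eqmodXM.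
Qed.
End LFunction.

(** * Nonvanishing of L-polynomials at [1/q] *)

Definition nonnegX (N : nat) (p : {poly rat}) := forall n, (n < N)%N -> 0 <= p`_n.

(** If [W] is the product, then [V_n = W_n + V_(n-d)] with [W_n >= 0]. *)
Lemma nonnegX_geometric N d (V : {poly rat}) : (0 < d)%N ->
  nonnegX N ((1 - 'X^d) * V) ->
  nonnegX N V /\ (forall n, (n + d < N)%N -> V`_n <= V`_(n + d)).
Proof.
move=> d0 h.
have hV n : (n + d < N)%N -> V`_n <= V`_(n + d).
  move=> /h; rewrite mulrBl mul1r coefB coefXnM ltnNge leq_addl /= addnK.
  by rewrite subr_ge0.
split=> // n; have [m] := ubnP n; elim: m n => // m IH n /ltnSE lenm ltnN.
have [ltnd|ledn] := ltnP n d.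
  by have := h n ltnN; rewrite mulrBl mul1r coefB coefXnM ltnd subr0.
have := hV (n - d)%N; rewrite subnK // => /(_ ltnN); apply: le_trans.
apply: IH; last exact: leq_ltn_trans (leq_subr _ _) ltnN.
by apply: leq_trans lenm; rewrite ltn_subrL d0 (leq_trans d0 ledn).
Qed.

(** The step [2d] serves all three values of [c]: the factors multiply to [1 - X^d], [(1 - X^d)^2]
    or [1 - X^(2d)]. *)
Lemma nonnegX_euler_factors N d c (V : {poly rat}) : (0 < d)%N ->
  c \in [:: 0; 1; -1] ->
  nonnegX N ((1 - 'X^d) * (1 - c *: 'X^d) * V) ->
  nonnegX N V /\ (forall n, (n + d.*2 < N)%N -> V`_n <= V`_(n + d.*2)).
Proof.
move=> d0; have two : nonnegX N ((1 - 'X^d) * V) ->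
    nonnegX N V /\ (forall n, (n + d.*2 < N)%N -> V`_n <= V`_(n + d.*2)).
  move=> /(nonnegX_geometric d0)[V0 Vd]; split=> // n; rewrite -addnn addnA => ltN.
  apply: le_trans (Vd (n + d)%N ltN); apply: Vd.
  by apply: leq_ltn_trans ltN; rewrite leq_addr.
rewrite !inE => /or3P[] /eqP->.
- by rewrite scale0r subr0 mulr1.
- by rewrite scale1r -mulrA => /(nonnegX_geometric d0)[]/two.
rewrite scaleN1r opprK -{1}(expr1n _ 2) => h.
apply: nonnegX_geometric; first by rewrite double_gt0.
move: h; congr nonnegX; congr (_ * _).
by rewrite -muln2 exprM -[in RHS](expr1n _ 2) subr_sqr expr1n.
Qed.

Section Nonvanishing.
Variables (K : finFieldType) (psi : {poly K} -> rat) (D : nat).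
Hypotheses (psiM : {morph psi : x y / x * y}) (psi1 : psi 1 = 1).
Hypothesis psi_sign : forall m, psi m \in [:: 0; 1; -1].
Hypothesis psi_orth : forall n, (D <= n)%N -> sieve_sum psi [::] n = 0.

Let q : rat := #|K|%:R.
Let q_neq0 : q != 0.
Proof. by rewrite pnatr_eq0 -lt0n; apply/card_gt0P; exists 0. Qed.

Lemma Lpoly_stable N : eqmodX N (Lpoly psi D [::]) (Lpoly psi N [::]).
Proof.
by move=> n ltnN; rewrite !coef_poly ltnN; case: ltnP => // /psi_orth->.
Qed.

(* If L(1/q) = 0, then L = (1 - q X) M, and M times the product over P of
   (1 - X^(deg P)) (1 - psi(P) X^(deg P)) is 1 formally.  Hence M, a polynomial
   with M_0 = 1, has nonnegative coefficients, and P = X gives M_n <= M_(n+2). *)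
Lemma Lpoly_neq0 : (Lpoly psi D [::]).[q^-1] != 0.
Proof.
apply/negP; rewrite -rootE => /factor_theorem[M0 LM0].
pose M := (- q^-1) *: M0.
have LM : Lpoly psi D [::] = (1 - q *: 'X) * M.
  rewrite LM0 mulrC /M -scalerAr scalerAl; congr (_ * M0).
  by rewrite scalerBr scalerA mulNr mulVf // scaleN1r opprK scaleNr alg_polyC addrC.
(* The contradiction occurs at index [2 * size M], which must lie below [N]; the extra 2 puts the
   prime [X] in [primes_below K N]. *)
pose N := (size M).*2.+2.
pose E1 P := euler_factor (fun _ : {poly K} => 1) P.
pose E2 P := euler_factor psi P.
have h : eqmodX N ((\prod_(P <- primes_below K N) (E1 P * E2 P)) * M) 1.
  rewrite big_split /= -mulrA mulrCA.
  apply: (@eqmodX_trans _ (\prod_(P <- primes_below K N) E2 P * Lpoly psi N [::]));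
    last exact: euler_product.
  apply: eqmodXM => //; apply: (@eqmodX_trans _ (Lpoly psi D [::]));
    last exact: Lpoly_stable.
  by rewrite LM; apply: eqmodXM => //; apply: zeta_euler_product.
have E1E P : E1 P = 1 - 'X^((size P).-1) by rewrite /E1 /euler_factor scale1r.
have prX : ('X : {poly K}) \in primes_below K N.
  apply/mem_primes_below; rewrite size_polyX; split=> //; split; last exact: monicX.
  by rewrite -['X]subr0 -polyC0; apply: irredp_XsubC.
have M00 : M`_0 = 1.
  have := h 0%N isT; rewrite coef1 eqxx -!horner_coef0 hornerM horner_prod.
  rewrite big1_seq ?mul1r // => P /andP[_ /mem_primes_below[[[sP _] _] _]].
  rewrite hornerM !hornerE /= expr0n -subn1 subn_eq0 leqNgt sP /=.
  by rewrite !mulr0 !subr0 mulr1.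
(* The prime [X] is kept for last: the other factors are divided out one by one, preserving
   nonnegativity. *)
move: h; rewrite (big_rem _ prX) /= => h.
have {h} : nonnegX N (E1 'X * E2 'X * M).
  have : nonnegX N ((\prod_(P <- rem 'X (primes_below K N)) (E1 P * E2 P)) *
    (E1 'X * E2 'X * M)).
    move=> n ltnN; rewrite mulrCA mulrA h // coef1; exact: ler0n.
  have : {in rem 'X (primes_below K N), forall P, monic_irreducible_poly P}.
    by move=> P /mem_rem /mem_primes_below[].
  elim: (rem _ _) => [|P A IH] miA; first by rewrite big_nil mul1r.
  rewrite big_cons -mulrA E1E => /nonnegX_euler_factors[] //.
    by have [[sP _] _] := miA P (mem_head _ _); rewrite -subn1 subn_gt0.
  by move=> + _; apply: IH => Q QA; apply: miA; rewrite inE QA orbT.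
rewrite E1E => /nonnegX_euler_factors[]//; first by rewrite size_polyX.
rewrite size_polyX /= => _ Mmono.
have : 1 <= M`_(size M).*2.
  rewrite -M00; have : ((size M).*2 < N)%N by rewrite /N.
  elim: (size M) => [|k IH] ltkN; first by rewrite lexx.
  apply: le_trans (IH _) _; first by apply: ltn_trans ltkN; rewrite doubleS.
  by have := Mmono k.*2; rewrite addn2 doubleS => ->.
by rewrite nth_default ?ler10 // -addnn leq_addl.
Qed.
End Nonvanishing.

(** * Primes with prescribed signs *)

Section SignPattern.
Variables (K : finFieldType) (r D N1 : nat) (psi : 'I_r -> {poly K} -> rat).
Hypothesis psiM : forall i, {morph psi i : x y / x * y}.
Hypothesis psi1 : forall i, psi i 1 = 1.
Hypothesis psi_sign : forall i m, psi i m \in [:: 0; 1; -1].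
Hypothesis psi_neq0 : forall i P, monic_irreducible_poly P -> (N1 < size P)%N ->
  psi i P != 0.

Definition prod_psi (S : {set 'I_r}) (m : {poly K}) := \prod_(i in S) psi i m.

Hypothesis psi_orth : forall (S : {set 'I_r}) n, S != set0 -> (D <= n)%N ->
  sieve_sum (prod_psi S) [::] n = 0.

Lemma prod_psiM S : {morph prod_psi S : x y / x * y}.
Proof. by move=> x y; rewrite /prod_psi -big_split; apply: eq_bigr => i _; exact: psiM. Qed.

Lemma prod_psi1 S : prod_psi S 1 = 1.
Proof. by rewrite /prod_psi big1. Qed.

Lemma prod_psi_sign S m : prod_psi S m \in [:: 0; 1; -1].
Proof.
rewrite /prod_psi; elim/big_ind: _ => // x y.
by rewrite !inE => /or3P[] /eqP-> /or3P[] /eqP->.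
Qed.

Definition toggle (i : 'I_r) (S : {set 'I_r}) := if i \in S then S :\ i else i |: S.

Lemma toggleK i : involutive (toggle i).
Proof.
move=> S; rewrite /toggle; have [iS|iS] := boolP (i \in S);
  first by rewrite !inE eqxx setD1K.
by rewrite !inE eqxx setU1K.
Qed.

Lemma odd_toggle i S : odd #|toggle i S| = ~~ odd #|S|.
Proof.
rewrite /toggle; case: ifP => iS; last by rewrite cardsU1 iS.
by rewrite [in RHS](cardsD1 i) iS /= negbK.
Qed.

Lemma prod_psi_toggle i S P : psi i P = 1 -> prod_psi (toggle i S) P = prod_psi S P.
Proof.
move=> psi_i; rewrite /prod_psi /toggle; case: ifP => iS.
  by rewrite [RHS](big_setD1 i) //= psi_i mul1r.
by rewrite big_setU1 ?iS //= psi_i mul1r.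
Qed.

(** [toggle i] changes the parity of [S] but not [prod_psi S P], so it matches the factors of the
    two products. *)
Lemma euler_factor_cancel i P : psi i P = 1 ->
  \prod_(S : {set 'I_r} | odd #|S|) euler_factor (prod_psi S) P =
  \prod_(S : {set 'I_r} | ~~ odd #|S|) euler_factor (prod_psi S) P.
Proof.
move=> psi_i; rewrite (reindex_inj (inv_inj (toggleK i))).
apply: eq_big => [S|S _]; first by rewrite odd_toggle.
by rewrite /euler_factor prod_psi_toggle.
Qed.

Let q : rat := #|K|%:R.
Let q_gt1 : 1 < q.
Proof. by rewrite ltr1n; apply: card_finNzRing_gt1. Qed.
Let q_neq0 : q != 0.
Proof. by rewrite gt_eqF // (lt_trans ltr01). Qed.

(** Vanishing would force [q^(deg P) = prod_psi S P], whereas [q^(deg P) > 1]. *)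
Lemma euler_factor_neq0 S P : monic_irreducible_poly P ->
  (euler_factor (prod_psi S) P).[q^-1] != 0.
Proof.
move=> [[sP _] _]; rewrite /euler_factor !hornerE subr_eq0 exprVn eq_sym.
apply/negP => e; have : q ^+ (size P).-1 = prod_psi S P.
  by rewrite -[LHS]mul1r -(eqP e) mulfVK // expf_neq0.
have : 1 < q ^+ (size P).-1 by rewrite exprn_egt1 // -lt0n -subn1 subn_gt0.
move=> /[swap] ->; have := prod_psi_sign S P.
by rewrite !inE => /or3P[] /eqP->.
Qed.

Lemma exists_prime_all_negative (N0 : nat) :
  exists P, [/\ monic_irreducible_poly P, (N0 < size P)%N & forall i, psi i P = -1].
Proof.
(* Above [N1] no [psi i P] vanishes, so a value other than -1 is 1. *)
pose Nm := maxn N0 N1.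
pose L S := Lpoly (prod_psi S) D [::].
pose ev S := ~~ odd #|S : {set 'I_r}|; pose od S := odd #|S : {set 'I_r}|.
pose Rod := \prod_(P <- primes_below K Nm) \prod_(S | od S) euler_factor (prod_psi S) P.
pose Rev := \prod_(P <- primes_below K Nm) \prod_(S | ev S) euler_factor (prod_psi S) P.
pose Lod := \prod_(S | od S) L S.
pose Lev := \prod_(S | ev S && (S != set0)) L S.
pose A : {poly rat} := Rod * ((1 - q *: 'X) * Lod); pose B : {poly rat} := Rev * Lev.
(* [N] bounds both sizes, so congruence of [A] and [B] modulo [X^N] is equality. *)
pose N := maxn Nm (maxn (size A) (size B)).
have [/hasP[P /mem_primes_below[miP _] /andP[sP /forallP nP]]|/hasPn none] :=
  boolP (has (fun P : {poly K} => (Nm < size P)%N && [forall i, psi i P == -1])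
    (primes_below K N)).
  exists P; split=> [//||i]; last exact/eqP.
  by apply: leq_ltn_trans sP; apply: leq_maxl.
(* [A] vanishes at [1/q] through its zeta factor, while no factor of [B] does. *)
suff AB : A = B.
  have root_zeta : (1 - q *: 'X).[q^-1] = 0 by rewrite !hornerE mulfV // subrr.
  have : A.[q^-1] == 0 by rewrite hornerM (hornerM (1 - _)) root_zeta mul0r mulr0.
  rewrite AB hornerM mulf_eq0 => /orP[]; rewrite horner_prod.
    rewrite prodf_seq_eq0 => /hasP[P /mem_primes_below[miP _]] /=.
    rewrite horner_prod prodf_seq_eq0 => /hasP[S _ /andP[_]].
    by rewrite (negbTE (euler_factor_neq0 S miP)).
  rewrite prodf_seq_eq0 => /hasP[S _ /andP[/andP[_ S0]]].
  rewrite (negbTE (Lpoly_neq0 _ _ _ _)) //.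
  - exact: prod_psiM.
  - exact: prod_psi1.
  - exact: prod_psi_sign.
  - by move=> n; apply: psi_orth.
suff h : eqmodX N A B.
  apply/polyP => n; have [|leNn] := ltnP n N; first exact: h.
  by move: leNn; rewrite /N !geq_max => /and3P[_ sA sB]; rewrite !nth_default.
pose E S := \prod_(P <- primes_below K N) euler_factor (prod_psi S) P.
(* The contribution of the large primes, common to both parities by [euler_factor_cancel]. *)
pose C := \prod_(P <- primes_below K N | (Nm < size P)%N)
  \prod_(S | ev S) euler_factor (prod_psi S) P.
have small (G : {poly K} -> {poly rat}) :
    \prod_(P <- primes_below K N | ~~ (Nm < size P)%N) G P =
    \prod_(P <- primes_below K Nm) G P.
  rewrite -big_filter; apply: perm_big; apply: uniq_perm;
    rewrite ?filter_uniq ?primes_below_uniq //.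
  move=> P; rewrite mem_filter -leqNgt; apply/andP/mem_primes_below.
    by move=> [sP /mem_primes_below[]].
  move=> [miP sP]; split=> //; apply/mem_primes_below; split=> //.
  by apply: leq_trans sP _; apply: leq_maxl.
have EevE : \prod_(S | ev S) E S = C * Rev.
  by rewrite exchange_big (bigID (fun P : {poly K} => (Nm < size P)%N)) /= small.
have EodE : \prod_(S | od S) E S = C * Rod.
  rewrite exchange_big (bigID (fun P : {poly K} => (Nm < size P)%N)) /= small;
    congr (_ * _).
  rewrite big_seq_cond [C]big_seq_cond; apply: eq_bigr => P /andP[PN sP].
  have /mem_primes_below[miP _] := PN.
  have := none P PN; rewrite sP /= negb_forall => /existsP[i psi_i].
  have psiP0 := psi_neq0 i miP (leq_ltn_trans (leq_maxr _ _) sP).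
  apply: (@euler_factor_cancel i); move: (psi_sign i P) psiP0 psi_i.
  by rewrite !inE => /or3P[] /eqP->; rewrite ?eqxx.
have EL S : S != set0 -> eqmodX N (E S * L S) 1.
  move=> S0; apply: (@eqmodX_trans _ (E S * Lpoly (prod_psi S) N [::])).
    by apply: eqmodXM => //; apply: Lpoly_stable => n; apply: psi_orth.
  by apply: euler_product; [apply: prod_psiM|apply: prod_psi1].
have hod : eqmodX N (\prod_(S | od S) E S * Lod) 1.
  rewrite -big_split; apply: (@eqmodX_trans _ (\prod_(S | od S) 1));
    last by rewrite big1_eq.
  apply: eqmodX_prod => S odS.
  by apply: EL; apply: contraTneq odS => ->; rewrite /od cards0.
have hev : eqmodX N (\prod_(S | ev S) E S * Lev) (1 - q *: 'X).
  rewrite (bigD1 set0) /=; last by rewrite /ev cards0.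
  rewrite -mulrA -[X in eqmodX _ _ X]mulr1; apply: eqmodXM.
    rewrite /E (eq_bigr (euler_factor (fun=> 1))); first exact: zeta_euler_product.
    by move=> P _; rewrite /euler_factor /prod_psi big_set0.
  rewrite -big_split; apply: (@eqmodX_trans _ (\prod_(S | ev S && (S != set0)) 1));
    last by rewrite big1_eq.
  by apply: eqmodX_prod => S /andP[_ S0]; apply: EL.
(* [hev] replaces [1 - q X] in [A] and [hod] replaces a factor 1 in [B]; both then become
   [C * Rod * Rev * Lev * Lod]. *)
apply: (@eqmodX_trans _ (Rod * ((\prod_(S | ev S) E S * Lev) * Lod))).
  by do 2 apply: eqmodXM => //; apply: eqmodX_sym.
apply: (@eqmodX_trans _ (Rev * ((\prod_(S | od S) E S * Lod) * Lev))); last first.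
  by rewrite -[X in eqmodX _ _ (_ * X)]mul1r; do 2 apply: eqmodXM => //.
move=> n _; congr (_`_n); rewrite EevE EodE.
by rewrite !mulrA [Rod * C]mulrC [Rev * C]mulrC -!mulrA; congr (C * _);
  rewrite mulrCA; congr (_ * (_ * _)); exact: mulrC.
Qed.
End SignPattern.

(** * The quadratic character and orthogonality *)

Section QuadraticCharacter.
Variable (K : finFieldType).
Hypothesis K_odd : odd #|K|.

Let h := (#|K|.-1)./2.
Let h2 : h.*2 = #|K|.-1.
Proof.
have q0 : (0 < #|K|)%N by apply/card_gt0P; exists 0.
by rewrite /h even_halfK //; move: K_odd; rewrite -{1}(prednK q0) /=.
Qed.

Lemma expf_pred_card (x : K) : x != 0 -> x ^+ #|K|.-1 = 1.
Proof.
move=> x0; have q0 : (0 < #|K|)%N by apply/card_gt0P; exists 0.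
by apply: (mulfI x0); rewrite -exprS prednK // expf_card mulr1.
Qed.

Lemma expf_half_card (x : K) : x != 0 -> x ^+ h = 1 \/ x ^+ h = -1.
Proof.
move=> /expf_pred_card; rewrite -h2 -muln2 exprM => /eqP.
by rewrite sqrf_eq1 => /orP[] /eqP; [left|right].
Qed.

Lemma opp1_neq1 : -1 != 1 :> K.
Proof.
apply/eqP => e; have h0 : (0 < h)%N.
  by rewrite -double_gt0 h2 -subn1 subn_gt0 card_finNzRing_gt1.
have two0 : 2%:R = 0 :> K by rewrite mulr2n -{1}e addNr.
have p2 : 2%N \in [pchar K] by rewrite inE /= two0 eqxx.
have c2 : #|K| = (2 ^ logn 2 #|K|)%N := card_pprimeChar p2.
have : odd #|K| = (logn 2 #|K| == 0)%N by rewrite {1}c2 oddX orbF.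
rewrite K_odd => /esym/eqP l0; move: (card_finNzRing_gt1 K).
by rewrite c2 l0.
Qed.

Definition qchar (x : K) : rat :=
  if x == 0 then 0 else if x ^+ h == 1 then 1 else -1.

Lemma qchar_eq0 x : (qchar x == 0) = (x == 0).
Proof. by rewrite /qchar; case: ifP => //; case: ifP. Qed.

Lemma qchar_sign x : qchar x \in [:: 0; 1; -1].
Proof. by rewrite /qchar; case: ifP => //; case: ifP. Qed.

Lemma qchar1 : qchar 1 = 1.
Proof. by rewrite /qchar oner_eq0 expr1n eqxx. Qed.

Lemma qcharM : {morph qchar : x y / x * y}.
Proof.
move=> x y; rewrite /qchar mulf_eq0; case: eqP => [_|/eqP x0] /=;
  first by rewrite mul0r.
case: eqP => [_|/eqP y0] /=; first by rewrite mulr0.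
rewrite exprMn.
by case: (expf_half_card x0) => ->; case: (expf_half_card y0) => ->;
  rewrite ?mulrNN ?mulr1 ?mul1r ?eqxx ?(negbTE opp1_neq1) ?mulrNN ?mulr1.
Qed.

(** Otherwise all [q - 1 = 2h] nonzero elements would be roots of [X^h - 1]. *)
Lemma qchar_nonresidue_exists : exists x, qchar x = -1.
Proof.
have q0 := card_finNzRing_gt1 K.
have h0 : (0 < h)%N by rewrite -double_gt0 h2 -subn1 subn_gt0.
have pn0 : 'X^h - 1 != 0 :> {poly K} by rewrite -size_poly_gt0 size_XnsubC.
have [/existsP[x /eqP hx]|] := boolP [exists x, qchar x == -1]; first by exists x.
rewrite negb_exists => /forallP nx.
have all_roots : all (root ('X^h - 1)) (enum [set~ (0 : K)]).
  apply/allP => x; rewrite mem_enum !inE => x0.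
  move: (nx x); rewrite /qchar (negbTE x0) rootE !hornerE.
  by case: ifP => [/eqP->|_]; rewrite ?subrr ?eqxx.
have := max_poly_roots pn0 all_roots (enum_uniq _).
rewrite size_XnsubC // -cardE cardsC1 -h2 ltnS -addnn.
by rewrite -{3}[h]addn0 leq_add2l leqn0 eqn0Ngt h0.
Qed.

Lemma sum_qchar : \sum_x qchar x = 0.
Proof.
have [v hv] := qchar_nonresidue_exists.
have v0 : v != 0 by rewrite -qchar_eq0 hv.
have : \sum_x qchar x = - \sum_x qchar x.
  rewrite {1}(reindex_inj (mulfI v0)) -sumrN; apply: eq_bigr => x _.
  by rewrite qcharM hv mulN1r.
by move/eqP; rewrite -addr_eq0 -mulr2n mulrn_eq0 => /eqP.
Qed.

(** A quadratic Dirichlet character modulo the product of the [t - b] for [b] in [B]. *)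
Definition qchar_at (B : {set K}) (m : {poly K}) : rat := \prod_(b in B) qchar m.[b].

Lemma qchar_atM B : {morph qchar_at B : x y / x * y}.
Proof.
by move=> x y; rewrite -big_split; apply: eq_bigr => b _; rewrite hornerM qcharM.
Qed.

Lemma qchar_at1 B : qchar_at B 1 = 1.
Proof. by rewrite /qchar_at big1 // => b _; rewrite hornerC qchar1. Qed.

Lemma qchar_at_sign B m : qchar_at B m \in [:: 0; 1; -1].
Proof.
rewrite /qchar_at; elim/big_ind: _ => // [x y|b _]; last exact: qchar_sign.
by rewrite !inE => /or3P[] /eqP-> /or3P[] /eqP->.
Qed.

Lemma qchar_at_prod B m : qchar_at B m = qchar (\prod_(b in B) m.[b]).
Proof. by rewrite /qchar_at (big_morph _ qcharM qchar1). Qed.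

Lemma qchar_at_neq0 B P : monic_irreducible_poly P -> (2 < size P)%N ->
  qchar_at B P != 0.
Proof.
move=> [[_ irrP] _] sP; rewrite prodf_seq_neq0; apply/allP => b _; apply/implyP => _.
rewrite qchar_eq0 -rootE root_factor_theorem; apply/negP => /irrP.
by rewrite size_XsubC => /(_ isT)/eqp_size; rewrite size_XsubC => e; rewrite -e in sP.
Qed.

(** A single condition on coefficient [n], visibly stable under translation by polynomials of lower
    degree. *)
Lemma monic_size_coef n (p : {poly_n.+1 K}) :
  (polyn p \is monic) && (size (polyn p) == n.+1) = ((polyn p)`_n == 1).
Proof.
apply/andP/eqP => [[mp /eqP sp]|pn].
  by move: mp; rewrite monicE /lead_coef sp => /eqP.
have sp : size (polyn p) = n.+1.
  apply/eqP; rewrite eqn_leq size_npoly ltnNge; apply/negP => sp.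
  by move/eqP: pn; rewrite nth_default // eq_sym oner_eq0.
by rewrite monicE /lead_coef sp pn.
Qed.

Section Orthogonality.
Variables (r : nat) (B : 'I_r -> {set K}).
(* For S nonempty with largest index i, the point b given for i occurs exactly
   once in prod_psi S: this is the independence of the characters. *)
Hypothesis B_triangular :
  forall i, exists2 b, b \in B i & forall j : 'I_r, (j < i)%N -> b \notin B j.

Lemma qchar_at_orth (S : {set 'I_r}) n : S != set0 -> (#|K| <= n)%N ->
  sieve_sum (prod_psi (fun i => qchar_at (B i)) S) [::] n = 0.
Proof.
move=> /set0Pn[i1 i1S] leqn.
have [i0 i0S i0max] : exists2 i0, i0 \in S & forall i, i \in S -> (i <= i0)%N.
  by case: (@arg_maxnP _ i1 (mem S) (fun i => nat_of_ord i) i1S) => i0 ? ?; exists i0.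
have [b0 b0B b0N] := B_triangular i0.
pose F := prod_psi (fun i => qchar_at (B i)) S.
pose rest (m : {poly K}) := (\prod_(b in B i0 :\ b0) qchar m.[b]) *
  \prod_(i in S :\ i0) qchar_at (B i) m.
have FE m : F m = qchar m.[b0] * rest m.
  rewrite /F /prod_psi (big_setD1 i0) //= {1}/qchar_at (big_setD1 b0) //= /rest.
  by rewrite mulrA.
(* Translating m by x D moves m(b0) through all of K as x varies and fixes the
   other values of m, so the sum factors through the sum of qchar over K. *)
pose D : {poly K} := \prod_(b <- enum [set~ b0]) ('X - b%:P).
have Db b : (D.[b] == 0) = (b != b0).
  by rewrite -rootE root_prod_XsubC mem_enum !inE.
have sD : size D = #|K|.
  rewrite size_prod_XsubC -cardE cardsC1 prednK //.
  exact: ltnW (card_finNzRing_gt1 K).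
have restD m x : rest (m + x *: D) = rest m.
  have mb b : b != b0 -> (m + x *: D).[b] = m.[b].
    by rewrite -Db => /eqP Db0; rewrite hornerD hornerZ Db0 mulr0 addr0.
  congr (_ * _); first by apply: eq_bigr => b /setD1P[bb0 _]; rewrite mb.
  apply: eq_bigr => i /setD1P[ii0 iS]; apply: eq_bigr => b bB; rewrite mb //.
  apply: contraTneq bB => ->; apply: b0N; rewrite ltn_neqAle i0max // andbT.
  by apply: contra ii0 => /eqP/val_inj->.
(* As [size D = q <= n], the polynomial [x D] fits in this type and has coefficient 0 at [n]. *)
pose t x : {poly_n.+1 K} := npolyp n.+1 (x *: D).
have tE x : polyn (t x) = x *: D.
  by rewrite npolypK // (leq_trans (size_scale_leq _ _)) // sD ltnW.
have tn x : (polyn (t x))`_n = 0.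
  by rewrite tE nth_default // (leq_trans (size_scale_leq _ _)) // sD.
have sumE : sieve_sum F [::] n = \sum_(v : {poly_n.+1 K} | (polyn v)`_n == 1)
  F (polyn v).
  by rewrite /sieve_sum; apply: eq_bigl => v; rewrite /= andbT monic_size_coef.
have shift x : sieve_sum F [::] n =
    \sum_(v : {poly_n.+1 K} | (polyn v)`_n == 1)
      qchar (polyn v + x *: D).[b0] * rest (polyn v).
  rewrite sumE (reindex_inj (addIr (t x))) /=; apply: eq_big => [v|v _].
    by rewrite coefD tn addr0.
  by rewrite FE tE restD.
(* The sum does not depend on [x], so it suffices that its [q] copies add up to 0. *)
have : \sum_(x : K) sieve_sum F [::] n = 0.
  rewrite (eq_bigr _ (fun x _ => shift x)) exchange_big big1 //= => v _.
  rewrite -mulr_suml; apply/eqP; rewrite mulf_eq0; apply/orP; left; apply/eqP.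
  have D0 : D.[b0] != 0 by rewrite Db eqxx.
  rewrite -[RHS]sum_qchar [RHS](reindex_inj (addrI (polyn v).[b0])).
  rewrite [RHS](reindex_inj (mulIf D0)).
  by apply: eq_bigr => x _; rewrite hornerD hornerZ.
rewrite sumr_const => /eqP; rewrite mulrn_eq0 => /orP[|/eqP//].
by rewrite cardE eqn0Ngt -cardE; move: (ltnW (card_finNzRing_gt1 K)) => /= ->.
Qed.

Lemma exists_prime_nonresidues N0 : exists P : {poly K},
  [/\ monic_irreducible_poly P, (N0 < size P)%N & forall i, qchar_at (B i) P = -1].
Proof.
apply: (@exists_prime_all_negative _ _ #|K| 2%N).
- by move=> i; apply: qchar_atM.
- by move=> i; apply: qchar_at1.
- by move=> i; apply: qchar_at_sign.
- by move=> i P; apply: qchar_at_neq0.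
- exact: qchar_at_orth.
Qed.
End Orthogonality.
End QuadraticCharacter.

(** * Norms from residue fields *)

Lemma pchar_nat_card (K : finFieldType) : [pchar K].-nat #|K|.
Proof.
have [p pr_p pK] := finPcharP K.
rewrite (card_pprimeChar pK : #|K| = _) pnatX.
by rewrite (eq_pnat _ (pcharf_eq pK)) pnat_id.
Qed.

Section Residue.
Variables (K : finFieldType) (P : {poly K}) (hP : monic_irreducible_poly P).
Local Notation L := {poly %/ P with hP}.
Local Notation w := ('qX : L).
Local Notation "p ^L" := (map_poly (in_alg L) p) (at level 2).
Local Notation q := #|K|.
Local Notation n := (size P).-1.

Lemma qfpoly_hornerE (p : {poly K}) : p^L.[w] = in_qpoly P p :> L.
Proof.
have := in_qpoly_comp_horner P p 'X; rewrite comp_polyXr => ->.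
congr (_.[_]); apply: eq_map_poly => x.
apply/val_inj; exact: (alg_polyC x).
Qed.

Lemma qfpoly_hornerK (x : L) : (polyn (x : {poly %/ P}))^L.[w] = x.
Proof. by rewrite qfpoly_hornerE; apply/val_inj/in_qpoly_small/size_mk_monic. Qed.

Lemma qfpoly_root (p : {poly K}) : (p^L.[w] == 0) = (P %| p).
Proof.
rewrite qfpoly_hornerE Pdiv.Idomain.dvdpE /Pdiv.Ring.rdvdp -val_eqE /=.
by rewrite mk_monicE.
Qed.

Lemma frobeniusD i (x y : L) : (x + y) ^+ (q ^ i) = x ^+ (q ^ i) + y ^+ (q ^ i).
Proof.
apply: exprDn_pchar; rewrite (eq_pnat _ (pchar_lalg L)) pnatX pchar_nat_card //.
Qed.

Lemma frobenius_const i (a : K) : a%:A ^+ (q ^ i) = a%:A :> L.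
Proof.
elim: i => [|i IH]; first by rewrite expr1.
by rewrite expnSr exprM IH -in_algE -rmorphXn /= expf_card.
Qed.

Lemma frobenius0 i : (0 : L) ^+ (q ^ i) = 0.
Proof. by rewrite expr0n expn_eq0 eqn0Ngt (ltnW (card_finNzRing_gt1 K)). Qed.

Lemma frobenius_horner i (p : {poly K}) (x : L) :
  p^L.[x] ^+ (q ^ i) = p^L.[x ^+ (q ^ i)].
Proof.
elim/poly_ind: p => [|p c IH]; first by rewrite rmorph0 !horner0 frobenius0.
rewrite rmorphD rmorphM /= map_polyX map_polyC !hornerE frobeniusD exprMn IH.
by rewrite frobenius_const.
Qed.

Lemma frobenius_inj i : injective (fun x : L => x ^+ (q ^ i)).
Proof.
move=> x y /= e; apply/eqP; rewrite -subr_eq0; apply/eqP.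
have : (x - y) ^+ (q ^ i) = 0.
  rewrite frobeniusD e -frobeniusD addrN frobenius0 //.
by move/eqP; rewrite expf_eq0 => /andP[_ /eqP].
Qed.

(** If [w^(q^k) = w] with [0 < k < n], then all of [L], consisting of polynomials in [w] over [K],
    is fixed by [x -> x^(q^k)], and [X^(q^k) - X] has [q^n] roots. *)
Lemma conjugates_uniq : uniq [seq w ^+ (q ^ i) | i <- iota 0 n].
Proof.
have q1 := card_finNzRing_gt1 K.
have h i j : (i < j)%N -> (j < n)%N -> w ^+ (q ^ i) != w ^+ (q ^ j).
  move=> ltij ltjn; apply/eqP => e.
  have {e} wk : w ^+ (q ^ (j - i)) = w.
    by apply: (@frobenius_inj i); rewrite /= -exprM -expnD subnK // ltnW.
  have k0 : (0 < j - i)%N by rewrite subn_gt0.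
  have k1 : (1 < q ^ (j - i))%N by rewrite -(expn0 q) ltn_exp2l.
  have pn0 : 'X^(q ^ (j - i)) - 'X != 0 :> {poly L}.
    rewrite -size_poly_gt0 size_polyDl ?size_polyXn //.
    by rewrite size_polyN size_polyX ltnS.
  have all_roots : all (root ('X^(q ^ (j - i)) - 'X)) (enum L).
    apply/allP => x _; rewrite rootE !hornerE; rewrite subr_eq0; apply/eqP.
    by rewrite -[x]qfpoly_hornerK frobenius_horner wk.
  have := max_poly_roots pn0 all_roots (enum_uniq _).
  rewrite size_polyDl ?size_polyXn; last by rewrite size_polyN size_polyX ltnS.
  rewrite -cardE card_qfpoly ltnS leq_exp2l // => lenk.
  by have := leq_ltn_trans (leq_trans lenk (leq_subr _ _)) ltjn; rewrite ltnn.
rewrite map_inj_in_uniq ?iota_uniq // => i j; rewrite !mem_iota /= !add0n => lti ltj e.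
by case: (ltngtP i j) => // /h; [move=> /(_ ltj)|move=> /(_ lti)]; rewrite e eqxx.
Qed.

(** Frobenius fixes the coefficients of [P], so the [n] distinct conjugates of [w] are roots, as
    many as the degree. *)
Lemma map_poly_conjugates : P^L = \prod_(i < n) ('X - (w ^+ (q ^ i))%:P).
Proof.
have [[sP _] mP] := hP.
have all_roots : all (root P^L) [seq w ^+ (q ^ i) | i <- iota 0 n].
  apply/allP => _ /mapP[i _ ->]; rewrite rootE -frobenius_horner.
  have /eqP-> : P^L.[w] == 0 by rewrite qfpoly_root dvdpp.
  by rewrite frobenius0.
have := all_roots_prod_XsubC _ all_roots.
rewrite size_map size_iota size_map_poly prednK ?(ltn_trans _ sP) //.
move=> /(_ erefl) -> //; last by rewrite uniq_rootsE conjugates_uniq.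
by rewrite lead_coef_map (monicP mP) rmorph1 scale1r big_map
  -(big_mkord xpredT (fun i => 'X - (w ^+ (q ^ i))%:P)) /index_iota subn0.
Qed.

(** The power is the norm of [b - w] from [L] to [K], since [(b - w)^(q^i) = b - w^(q^i)]. *)
Lemma sub_conjugates (b : K) : P.[b]%:A = (b%:A - w) ^+ (\sum_(i < n) q ^ i) :> L.
Proof.
rewrite -in_algE -horner_map /= map_poly_conjugates horner_prod -prodrXr.
apply: eq_bigr => i _; rewrite hornerXsubC.
apply/eqP; rewrite subr_eq; apply/eqP.
by rewrite -frobeniusD subrK frobenius_const.
Qed.

(** If the product were [y^2], its norm raised to the power [(q - 1) / 2] would be
    [y^(q^n - 1) = 1], making the norm a square in [K]. *)
Lemma nonresidue_of_norm (B : {set K}) : odd q -> qchar_at B P = -1 ->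
  forall y : L, y ^+ 2 != \prod_(b in B) (b%:A - w).
Proof.
move=> q_odd hB y; apply/eqP => e.
have hN : (\prod_(b in B) P.[b])%:A = y ^+ 2 ^+ (\sum_(i < n) q ^ i) :> L.
  rewrite -in_algE rmorph_prod e -prodrXl; apply: eq_bigr => b _; exact: sub_conjugates.
move: hB; rewrite qchar_at_prod // /qchar.
case: ifP => // N0; case: ifP => // /negP[]; apply/eqP.
have q0 : (0 < q)%N by apply: ltnW; apply: card_finNzRing_gt1.
have y0 : y != 0.
  apply: contraFneq N0 => y0; rewrite -(fmorph_eq0 (in_alg L)) /= hN y0 -exprM.
  have n0 : (0 < n)%N by have [[sP _] _] := hP; rewrite -subn1 subn_gt0.
  rewrite expr0n muln_eq0 sum_nat_eq0 -[X in _ || X]negbK negb_forall /=.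
  suff -> : [exists i : 'I_n, (q ^ i != 0)%N] by [].
  by apply/existsP; exists (Ordinal n0).
apply: (fmorph_inj (in_alg L)); rewrite rmorphXn rmorph1 /= hN -!exprM.
have -> : (2 * (\sum_(i < n) q ^ i) * (q.-1)./2 = #|L|.-1)%N.
  rewrite mulnAC mul2n even_halfK; last by move: q_odd; rewrite -{1}(prednK q0).
  by rewrite card_qfpoly predn_exp.
exact: expf_pred_card.
Qed.
End Residue.

(** * Quartics and residue points *)

(** A root [x] would give [a y^2 = - e] at [y = x^2 + b]. A splitting into quadratics reads
    [a (T^2 - x T + t) (T^2 + x T + y)] with [x (t - y) = 0]: if [t = y] then [a y^2 = a b^2 + e],
    and if [x = 0] then [a ((t - y) / 2)^2 = - e]. *)
Lemma quartic_irreducible (k : fieldType) (a b e : k) : 2%:R != 0 :> k -> a != 0 ->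
  (forall y, a * y ^+ 2 != - e) -> (forall y, a * y ^+ 2 != a * b ^+ 2 + e) ->
  irreducible_poly (a%:P * ('X ^+ 2 + b%:P) ^+ 2 + e%:P).
Proof.
move=> two0 a0 h1 h2; set g := _ + _.
have gE : g = a *: 'X^4 + (2%:R * (a * b)) *: 'X^2 + (a * b ^+ 2 + e)%:P.
  rewrite /g -!mul_polyC !(polyCD, polyCM, polyC_natr); ring.
have noroot x : ~~ root g x.
  rewrite rootE /g !(hornerD, hornerM, hornerC, horner_exp, hornerX) addr_eq0.
  exact: h1.
have g4 : g`_4 = a by rewrite gE !(coefD, coefZ, coefXn, coefC) /= mulr1 mulr0 !addr0.
have sg : size g = 5%N.
  apply/eqP; rewrite eqn_leq; apply/andP; split.
    apply/leq_sizeP => j lj; rewrite gE !(coefD, coefZ, coefXn, coefC).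
    by rewrite !gtn_eqF ?(leq_trans _ lj) // !mulr0 !addr0.
  by rewrite ltnNge; apply/negP => /leq_sizeP/(_ 4 isT); rewrite g4 => /eqP;
    rewrite (negbTE a0).
have g0 : g != 0 by rewrite -size_poly_eq0 sg.
split=> [|u su ug]; first by rewrite sg.
have [v gvu] := dvdpP _ _ ug.
have := g0; rewrite gvu mulf_eq0 negb_or => /andP[v0 u0].
have suv : (size v + size u)%N = 6%N.
  have := size_mul v0 u0; rewrite -gvu sg; case: (_ + _)%N => //= n -> //.
rewrite -gvu -dvdp_size_eqp // sg.
(* The sizes of [u] and [v] add up to 6; without linear factors, either [v] is constant or both
   sizes are 3. *)
have nolin (t : {poly k}) : t %| g -> size t != 2%N.
  move=> /dvdpP[t' gt]; apply/eqP => /poly2_root[x tx].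
  by have := noroot x; rewrite gt rootM tx orbT.
have nu := nolin u ug.
have nv : size v != 2%N by apply: nolin; rewrite gvu dvdp_mulr.
move: u0 v0; rewrite -!size_poly_gt0.
case su3 : (size u == 3%N); last first.
  by move: su nu nv su3 suv; move: (size u) (size v) => m n; lia.
have {}su3 := eqP su3; have sv3 : size v = 3%N.
  by move: suv; rewrite su3; move: (size v) => m; lia.
have big_coef (t : {poly k}) i : size t = 3%N -> t`_i.+3 = 0.
  by move=> st; rewrite nth_default ?st.
have cf i : (v * u)`_i = g`_i by rewrite gvu.
move: (cf 0%N) (cf 1%N) (cf 2) (cf 3) (cf 4).
rewrite g4 gE !coefM !big_ord_recr big_ord0 /= !(coefD, coefZ, coefXn, coefC) /=.
rewrite !big_coef //.
set v0 := v`_0; set v1 := v`_1; set v2 := v`_2; set u0 := u`_0; set u1 := u`_1;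
  set u2 := u`_2.
rewrite !(big_ord0, mulr0, mul0r, addr0, add0r, mulr1).
move=> c0 c1 c2 c3 c4 _ _; exfalso.
have /andP[v20 u20] : (v2 != 0) && (u2 != 0) by rewrite -negb_or -mulf_eq0 c4.
have [x Eu1] : exists x, u1 = x * u2 by exists (u1 / u2); rewrite divfK.
have [y Eu0] : exists y, u0 = y * u2 by exists (u0 / u2); rewrite divfK.
have [t Ev0] : exists t, v0 = t * v2 by exists (v0 / v2); rewrite divfK.
have Ev1 : v1 = - x * v2.
  apply: (mulIf u20); rewrite -[LHS](addrK (v2 * u1)) c3 Eu1; ring.
have aty : a * (t * y) = a * b ^+ 2 + e by rewrite -c0 Ev0 Eu0 -c4; ring.
have : a * x * (t - y) = 0 by rewrite -c1 Ev0 Ev1 Eu0 Eu1 -c4; ring.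
move=> /eqP; rewrite !mulf_eq0 (negbTE a0) /= => /orP[/eqP x0|]; last first.
  rewrite subr_eq0 => /eqP tyE; have := h2 y.
  by rewrite -aty tyE expr2 eqxx.
have tyE : t + y = 2%:R * b.
  apply: (mulfI a0); rewrite mulrCA -c2 Ev0 Ev1 Eu0 Eu1 x0 -c4; ring.
have bE : b = (t + y) / 2%:R by rewrite tyE mulrC mulKf.
have eE : e = a * (t * y) - a * b ^+ 2 by rewrite aty addrC addKr.
have := h1 ((t - y) / 2%:R); rewrite eE bE => /eqP; apply.
by field.
Qed.

Lemma exists_splitting_field (F : finFieldType) (g : {poly F}) : g != 0 ->
  exists (K : finFieldType) (i : {rmorphism F -> K}) (rs : seq K),
    map_poly i g %= \prod_(z <- rs) ('X - z%:P).
Proof.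
move=> /FinSplittingFieldFor[L [rs grs _]].
by exists (FinFieldExtType L), (in_alg L), rs.
Qed.

Lemma exists_minimal_poly (F : finFieldType) (L : finFieldType)
    (j : {rmorphism F -> L}) (u : L) :
  exists2 f, monic_irreducible_poly f & root (map_poly j f) u.
Proof.
have [g g0 gu] : exists2 g : {poly F}, g != 0 & root (map_poly j g) u.
  have q1 := card_finNzRing_gt1 L; exists ('X^#|L| - 'X).
    rewrite -size_poly_gt0 size_polyDl ?size_polyXn //.
    by rewrite size_polyN size_polyX ltnS.
  by rewrite rootE rmorphB rmorphXn /= map_polyX !hornerE expf_card subrr.
have [n] := ubnP (size g); elim: n g g0 gu => // n IH g g0 gu /ltnSE sg.
have g1 : (1 < size g)%N.
  rewrite ltnNge; apply/negP => /size1_polyC gC; move: g0 gu.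
  by rewrite gC polyC_eq0 map_polyC rootC /= fmorph_eq0 => /negbTE->.
have [P miP /dvdpP[h ghP]] := exists_irreducible_factor g1.
move: gu; rewrite ghP rmorphM rootM => /orP[hu|]; last by exists P.
move: g0; rewrite ghP mulf_eq0 negb_or => /andP[h0 P0].
have [[sP _] _] := miP; apply: (IH h h0 hu); apply: leq_trans sg.
rewrite ghP size_mul //; case: (size P) sP => [|[|m]] // _.
by rewrite !addnS /= ltnS leq_addr.
Qed.

(** Squares of the residue field go to squares of [L] under this embedding, so nonsquares need only
    be found in [L]. *)
Lemma exists_residue_morphism (F : finFieldType) (L : finFieldType)
    (j : {rmorphism F -> L}) (u : L)
    (f : {poly F}) (hf : monic_irreducible_poly f) : root (map_poly j f) u ->
  exists th : {rmorphism {poly %/ f with hf} -> L},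
    (forall a, th a%:A = j a) /\ th 'qX = u.
Proof.
move=> fu; pose th0 (x : {poly %/ f with hf}) :=
  (map_poly j (polyn (x : {poly %/ f}))).[u].
have thE (m : {poly F}) : th0 (in_qpoly f m) = (map_poly j m).[u].
  rewrite /th0 /= mk_monicE // [in RHS](Pdiv.IdomainMonic.divp_eq hf.2 m)
    -Pdiv.IdomainMonic.modpE ?hf //.
  by rewrite rmorphD rmorphM /= !hornerE (eqP fu) mulr0 add0r.
have inK (x : {poly %/ f with hf}) : in_qpoly f (polyn (x : {poly %/ f})) = x.
  by apply/val_inj/in_qpoly_small/size_mk_monic.
have thB : zmod_morphism th0 by move=> x y; rewrite /th0 /= rmorphB /= !hornerE.
have thM : monoid_morphism th0.
  split; first by rewrite /th0 [polyn _](_ : _ = 1) // rmorph1 hornerC.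
  by move=> x y; rewrite -{1}(inK x) -{1}(inK y) -in_qpolyM thE rmorphM hornerM.
pose th : {rmorphism {poly %/ f with hf} -> L} :=
  HB.pack th0 (GRing.isZmodMorphism.Build _ _ th0 thB)
    (GRing.isMonoidMorphism.Build _ _ th0 thM).
exists th; split=> [a|]; last by rewrite /= thE map_polyX hornerX.
rewrite /= /th0.
have -> : polyn (a%:A : {poly %/ f}) = a%:P by exact: alg_polyC.
by rewrite map_polyC hornerC.
Qed.

(** Separability allows a product over a set of roots, as in [qchar_at]. *)
Lemma split_prod_roots (K : finFieldType) (rs : seq K) (f : {poly K}) :
  f \is monic -> separable_poly f -> f %| \prod_(z <- rs) ('X - z%:P) ->
  f = \prod_(b in [set x | root f x]) ('X - b%:P).
Proof.
move=> mf sf /dvdp_prod_XsubC[m]; set ts := mask m rs.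
rewrite eqp_monic ?monic_prod_XsubC // => /eqP fE.
have uts : uniq ts by rewrite -separable_prod_XsubC -fE.
rewrite [LHS]fE big_uniq //=; apply: eq_bigl => x.
by rewrite inE fE root_prod_XsubC.
Qed.

Lemma prod_sub_even (K : finFieldType) (L : comNzRingType) (j : {rmorphism K -> L})
    (B : {set K}) (w : L) : ~~ odd #|B| ->
  \prod_(b in B) (j b - w) = (map_poly j (\prod_(b in B) ('X - b%:P))).[w].
Proof.
move=> evB; rewrite rmorph_prod horner_prod.
rewrite (eq_bigr (fun b => - (w - j b))) => [|b _]; last by rewrite opprB.
rewrite prodrN -signr_odd (negbTE evB) mul1r; apply: eq_bigr => b _.
by rewrite rmorphB /= map_polyX map_polyC hornerXsubC.
Qed.

(** * A point of large degree satisfying the nonsquare conditions *)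

Section ResiduePoint.
Variables (F : finFieldType) (p : nat) (pF : p \in [pchar F]) (p2 : p != 2%N).
Variables (g d : F) (g0 : g != 0) (d0 : d != 0).

Let pr_p : prime p := pcharf_prime pF.
Let p_odd : odd p.
Proof. by have [/eqP|//] := even_prime pr_p; rewrite (negbTE p2). Qed.

Lemma two_neq0 : 2%:R != 0 :> F.
Proof. by rewrite -(dvdn_pcharf pF) dvdn_prime2. Qed.

(** These are the hypotheses of [quartic_irreducible] for [pi1], then for [pi2], with [g] and [d] in
    the role of the [p]-th roots of the constants and [w^p] in that of [u_0]. The last clause, a
    lower bound on the degree of [w], yields infinitely many points. *)
Lemma exists_residue_point N :
  exists (L : finFieldType) (j : {rmorphism F -> L}) (w : L),
  [/\ forall y, j g * y ^+ 2 != - (j d * w),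
      forall y, j g * y ^+ 2 != j g * (w ^+ p) ^+ 2 + j d * w,
      forall y, j (4%:R * g) * y ^+ 2 != - (1 + 4%:R * (j d * w)),
      forall y, j (4%:R * g) * y ^+ 2 != j (4%:R * g) * (w ^+ p) ^+ 2 +
        (1 + 4%:R * (j d * w))
    & forall h : {poly F}, h != 0 -> (size h <= N)%N -> ~~ root (map_poly j h) w].
Proof.
have two0 := two_neq0.
have four0 : 4%:R != 0 :> F by rewrite (natrM _ 2 2) mulf_neq0.
(* Divided by [g] or [4 g], the four conditions concern [- e w], [w^(2p) + e w], [e (a - w)] and
   [w^(2p) + e w + k]. *)
pose e := d / g; have e0 : e != 0 by rewrite mulf_neq0 ?invr_neq0.
pose a := - (4%:R * d)^-1; have a0 : a != 0 by rewrite oppr_eq0 invr_eq0 mulf_neq0.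
pose k := (4%:R * g)^-1; have k0 : k != 0 by rewrite invr_eq0 mulf_neq0.
have p3 : (2 < p)%N by rewrite ltn_neqAle eq_sym p2 prime_gt1.
pose f (c : F) : {poly F} := 'X^(2 * p) + (e *: 'X + c%:P).
have sle c : (size (e *: 'X + c%:P)%R < (2 * p).+1)%N.
  apply: leq_ltn_trans (size_polyD _ _) _; rewrite size_scale // size_polyX.
  rewrite gtn_max !ltnS; apply/andP; split; first by lia.
  by apply: leq_trans (size_polyC_leq1 _) _; lia.
have sf c : size (f c) = (2 * p).+1 by rewrite size_polyDl size_polyXn.
have mf c : f c \is monic by rewrite monicE lead_coefDl ?size_polyXn // lead_coefXn.
(* The derivative is the nonzero constant [e], as [2p = 0] in [F]. *)
have fsep c : separable_poly (f c).
  rewrite separable_poly.unlock !derivD derivXn derivZ derivX derivC addr0.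
  rewrite -scaler_nat natrM (pcharf0 pF) mulr0 scale0r add0r alg_polyC.
  by rewrite coprimep_sym -[e%:P]mulr1 mul_polyC coprimepZl ?coprime1p.
(* The last factor makes [e] a square in [K], so it drops out of [- e w] and [e (a - w)]. *)
pose G := f 0 * f k * ('X^2 - e%:P).
have sX2 : size ('X^2 - e%:P) = 3%N by rewrite size_XnsubC.
have G0 : G != 0.
  by rewrite !mulf_neq0 ?(monic_neq0 (mf _)) // -size_poly_gt0 sX2.
have [K [i [rs Grs]]] := exists_splitting_field G0.
have dvG (h : {poly F}) : h %| G -> map_poly i h %| \prod_(z <- rs) ('X - z%:P).
  by move=> hG; rewrite -(eqp_dvdr _ Grs) dvdp_map.
pose B c := [set x | root (map_poly i (f c)) x].
have BE c : f c %| G -> map_poly i (f c) = \prod_(b in B c) ('X - b%:P).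
  move=> /dvG; apply: split_prod_roots; first by rewrite map_monic.
  by rewrite separable_map.
have f0G : f 0 %| G by rewrite /G -mulrA dvdp_mulr.
have fkG : f k %| G by rewrite /G dvdp_mulr // dvdp_mull.
have BE0 := BE _ f0G; have BEk := BE _ fkG.
have card_B c : f c %| G -> #|B c| = (2 * p)%N.
  move=> /BE; rewrite -big_enum /= => /(congr1 (fun h : {poly K} => size h)).
  by rewrite size_map_poly sf size_prod_XsubC -cardE => -[].
have [s s2] : exists s : K, s ^+ 2 = i e.
  have [m] := dvdp_prod_XsubC (dvG _ (dvdp_mull (f 0 * f k) (dvdpp ('X^2 - e%:P)))).
  move=> eqm; have := eqp_size eqm; rewrite size_map_poly sX2 size_prod_XsubC.
  case: (mask m rs) eqm => [//|s ts] eqm _; exists s.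
  have : root (map_poly i ('X^2 - e%:P)) s.
    by rewrite (eqp_root eqm) root_prod_XsubC mem_head.
  rewrite rootE rmorphB /= map_polyXn map_polyC !(hornerD, hornerN, hornerC, hornerXn).
  by rewrite subr_eq0 => /eqP.
have s0 : s != 0 by rewrite -sqrf_eq0 s2 fmorph_eq0.
have pK : p \in [pchar K] by rewrite (fmorph_pchar i).
have K_odd : odd #|K|.
  by rewrite (card_pprimeChar pK : #|K| = _) oddX p_odd orbT.
pose Bs (n : 'I_4) := nth set0 [:: [set 0]; [set i a]; B 0; B k] n.
have fE c (x : K) : (map_poly i (f c)).[x] = x ^+ (2 * p) + i e * x + i c.
  rewrite !rmorphD /= map_polyXn map_polyZ map_polyX map_polyC.
  by rewrite !(hornerD, hornerXn, hornerZ, hornerX, hornerC) addrA.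
(* [B 0] has [2p > 2] elements, hence one outside [{0, a}]. [B k] avoids all earlier sets: [f k]
   takes the nonzero values [k] at 0 and [a^(2p)] at [a], because [e a + k = 0], and
   [f k - f 0 = k]. *)
have Bs_tri n : exists2 b, b \in Bs n & forall m : 'I_4, (m < n)%N -> b \notin Bs m.
  case: n => [[|[|[|[|n]]]] ltn] //=.
  - by exists 0; rewrite /Bs ?inE.
  - exists (i a); first by rewrite /Bs inE.
    by case=> [[|m] ltm] //= _; rewrite /Bs inE fmorph_eq0.
  - have /subsetPn[b bB b2] : ~~ (B 0 \subset [set 0; i a]).
      apply/negP => /subset_leq_card; rewrite card_B // cards2.
      move=> /leq_trans/(_ (_ : _ <= 2)%N) h;
        have : (2 * p <= 2)%N by apply: h; case: (_ != _).
      by rewrite -[X in (_ <= X)%N]muln1 leq_pmul2l // leqNgt prime_gt1.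
    exists b => // -[[|[|m]] ltm] //= _; apply: contra b2; rewrite /Bs !inE => ->//.
    by rewrite orbT.
  have [b bB] : exists b, b \in B k.
    by apply/card_gt0P; rewrite card_B // muln_gt0 (prime_gt0 pr_p).
  have ka : i e * i a + i k = 0.
    rewrite -rmorphM -rmorphD /=; suff -> : e * a + k = 0 by rewrite rmorph0.
    by rewrite /e /a /k; field; rewrite g0 d0 four0.
  move: bB; rewrite inE rootE fE => /eqP bB.
  exists b; first by rewrite /Bs inE rootE fE bB.
  move=> [[|[|[|m]]] ltm] //= _; rewrite /Bs /= !inE ?rootE ?fE.
  - apply: contra_eq_neq bB => ->.
    by rewrite expr0n muln_eq0 (gtn_eqF (prime_gt0 pr_p)) mulr0 !add0r fmorph_eq0.
  - apply: contra_eq_neq bB => ->.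
    by rewrite -addrA ka addr0 expf_neq0 // fmorph_eq0.
  apply: contra_eq_neq bB; rewrite rmorph0 addr0 => ->.
  by rewrite add0r fmorph_eq0.
have [P [miP sP nP]] := exists_prime_nonresidues K_odd Bs_tri N.
pose L := {poly %/ P with miP}; pose w : L := 'qX.
pose j : {rmorphism F -> L} := in_alg L \o i.
have nsq n y : y ^+ 2 != \prod_(b in Bs n) (b%:A - w) by apply: nonresidue_of_norm.
have jg0 : j g != 0 by rewrite fmorph_eq0.
have j40 : 4%:R != 0 :> L by rewrite -(rmorph_nat j 4) fmorph_eq0.
pose s' : L := s%:A.
have s'0 : s' != 0 by rewrite /s' -in_algE fmorph_eq0.
have s'2 : j e = s' ^+ 2 by rewrite /j /= -s2 -in_algE rmorphXn.
have jd : j d = j g * s' ^+ 2 by rewrite -s'2 -rmorphM /= /e mulrC divfK.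
have n0 y : y ^+ 2 != - w.
  by have := nsq 0 y; rewrite big_set1 scale0r sub0r.
have n1 y : y ^+ 2 != j a - w.
  by have := nsq 1 y; rewrite big_set1.
have fjE c : f c %| G -> \prod_(b in B c) (b%:A - w) = (w ^+ p) ^+ 2 + j e * w + j c.
  move=> fcG; have -> : \prod_(b in B c) (b%:A - w) =
      (map_poly (in_alg L) (map_poly i (f c))).[w].
    by rewrite BE // -prod_sub_even // card_B // oddM.
  rewrite -map_poly_comp !rmorphD /= map_polyXn map_polyZ map_polyX map_polyC.
  by rewrite !(hornerD, hornerXn, hornerZ, hornerX, hornerC) addrA mulnC exprM.
have n2 y : y ^+ 2 != (w ^+ p) ^+ 2 + j e * w.
  by have := nsq (inord 2) y; rewrite /Bs inordK //= fjE // rmorph0 addr0.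
have n3 y : y ^+ 2 != (w ^+ p) ^+ 2 + j e * w + j k.
  by have := nsq (inord 3) y; rewrite /Bs inordK //= fjE.
have j4g : j (4%:R * g) = 4%:R * j g by rewrite rmorphM rmorph_nat.
have ja : 4%:R * (j g * s' ^+ 2) * j a = -1.
  rewrite -jd -(rmorph_nat j) -!rmorphM /= /a mulrN mulfV ?mulf_neq0 //.
  by rewrite rmorphN rmorph1 scaleN1r.
have jk : 4%:R * j g * j k = 1.
  by rewrite -j4g -rmorphM /= /k mulfV ?mulf_neq0 // rmorph1 scale1r.
exists L, j, w; split => [y|y|y|y|h h0 sh].
- apply: contraNN (n0 (y / s')) => /eqP E; apply/eqP.
  have yE : y = y / s' * s' by rewrite divfK.
  apply: (mulfI jg0); apply: (mulfI (expf_neq0 2 s'0)).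
  have -> : s' ^+ 2 * (j g * (y / s') ^+ 2) = j g * (y / s' * s') ^+ 2 by ring.
  rewrite -yE E jd; ring.
- apply: contraNN (n2 y) => /eqP E; apply/eqP/(mulfI jg0).
  rewrite E jd s'2; ring.
- apply: contraNN (n1 (y / s')) => /eqP E; apply/eqP.
  have yE : y = y / s' * s' by rewrite divfK.
  apply: (mulfI jg0); apply: (mulfI (expf_neq0 2 s'0)); apply: (mulfI j40).
  have -> : 4%:R * (s' ^+ 2 * (j g * (y / s') ^+ 2)) =
      4%:R * j g * (y / s' * s') ^+ 2 by ring.
  rewrite -yE -j4g E jd.
  have -> : 4%:R * (s' ^+ 2 * (j g * (j a - w))) =
    4%:R * (j g * s' ^+ 2) * j a - 4%:R * (j g * s' ^+ 2 * w) by ring.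
  rewrite ja; ring.
- apply: contraNN (n3 y) => /eqP E; apply/eqP.
  apply: (mulfI jg0); apply: (mulfI j40).
  rewrite mulrA -j4g E j4g jd s'2.
  have -> : 4%:R * (j g * ((w ^+ p) ^+ 2 + s' ^+ 2 * w + j k)) =
    4%:R * (j g * ((w ^+ p) ^+ 2 + s' ^+ 2 * w)) + 4%:R * j g * j k by ring.
  rewrite jk; ring.
(* Vanishing at [w] means divisibility by [P], impossible as [size h <= N < size P]. *)
have -> : map_poly j h = map_poly (in_alg L) (map_poly i h) by rewrite -map_poly_comp.
rewrite rootE qfpoly_root; apply: contraTN sP => /dvdp_leq.
rewrite map_poly_eq0 => /(_ h0); rewrite size_map_poly => /leq_trans/(_ sh).
by rewrite -leqNgt.
Qed.
End ResiduePoint.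

(** * The [p]-th root and descent to closed points *)

Lemma prootK (F : finFieldType) p (x : F) : p \in [pchar F] -> proot p x ^+ p = x.
Proof.
move=> pF; rewrite /proot; case: pickP => [y /eqP//|/= nroot].
have cF : #|F| = (p ^ logn p #|F|)%N := card_pprimeChar pF.
have l0 : (0 < logn p #|F|)%N.
  by rewrite lt0n; apply: contraTneq (card_finNzRing_gt1 F) => l0; rewrite cF l0.
(* Its [p]-th power is [x^#|F| = x], so the default value in [proot] is never reached. *)
have := nroot (x ^+ (p ^ (logn p #|F|).-1)).
by rewrite -exprM -expnSr prednK // -cF expf_card eqxx.
Qed.

(* Infinitely many closed points: no finite list contains all of them. *)
Theorem theorem5p1 (F : finFieldType) (p : nat)
  (hp : p \in [pchar F]) (hp2 : p != 2%N) (c d : F)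
  (hc : c != 0) (hd : d != 0) :
  forall s : seq {poly F},
    exists (f : {poly F}) (hf : monic_irreducible_poly f),
      f \notin s /\ irreducible_poly (pi1 p c d hf)
      /\ irreducible_poly (pi2 p c d hf).
Proof.
move=> s; pose M := (\max_(h <- s) size h)%N.
have p0 : (0 < p)%N := prime_gt0 (pcharf_prime hp).
have proot_neq0 (x : F) : x != 0 -> proot p x != 0.
  by move=> x0; apply: contraNneq x0 => e; rewrite -(prootK x hp) e expr0n gtn_eqF.
(* For [f] in [s], the polynomial [f(X^p)] has size at most this bound, so it cannot vanish at [w],
   whereas the [f] chosen below vanishes at [w^p]. *)
have [L [j [w [h1 h2 h3 h4 hw]]]] :=
  exists_residue_point hp hp2 (proot_neq0 c hc) (proot_neq0 d hd) (M.-1 * p).+1.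
have [f hf fu] := exists_minimal_poly j (w ^+ p).
exists f, hf.
have [th [thC thX]] := exists_residue_morphism hf fu.
have pL : p \in [pchar L] by rewrite (fmorph_pchar j).
have pQ : p \in [pchar {poly %/ f with hf}] by rewrite (pchar_lalg _).
set u0 : {poly %/ f with hf} := 'qX.
(* Both sides have [p]-th power [w^p], and Frobenius is injective on [L]. *)
have thv : th (proot p u0) = w.
  apply: (fmorph_inj (pFrobenius_aut pL)); rewrite /= !pFrobenius_autE -rmorphXn.
  by rewrite prootK // thX.
have two0 : 2%:R != 0 :> {poly %/ f with hf}.
  by rewrite -(rmorph_nat (in_alg _)) fmorph_eq0 (two_neq0 hp hp2).
have four0 : 4%:R != 0 :> {poly %/ f with hf} by rewrite (natrM _ 2 2) mulf_neq0.
have gA0 : (proot p c)%:A != 0 :> {poly %/ f with hf}.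
  by rewrite -in_algE fmorph_eq0 proot_neq0.
have th4 : th (4%:R * (proot p c)%:A) = j (4%:R * proot p c).
  by rewrite !rmorphM !rmorph_nat /= thC.
have the : th (1 + 4%:R * ((proot p d)%:A * proot p u0)) =
    1 + 4%:R * (j (proot p d) * w).
  by rewrite rmorphD rmorph1 !rmorphM rmorph_nat thC thv.
split; last split.
- apply/negP => fs.
  have [[sf _] mf] := hf.
  have fX0 : f \Po 'X^p != 0.
    by rewrite comp_poly_eq0 ?monic_neq0 // size_polyXn.
  have szfX : size (f \Po 'X^p) = ((size f).-1 * p).+1.
    by rewrite -[LHS]prednK ?size_poly_gt0 // size_comp_poly size_polyXn.
  have := hw _ fX0; rewrite szfX ltnS leq_mul2r.
  have -> : ((size f).-1 <= M.-1)%N.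
    have : (size f <= M)%N.
      exact: (@leq_bigmax_seq _ s xpredT (fun h : {poly F} => size h) f fs isT).
    by rewrite -!subn1 => /(leq_sub2r 1).
  rewrite orbT => /(_ isT)/negP; apply.
  by rewrite rootE map_comp_poly map_polyXn horner_comp hornerXn.
- apply: quartic_irreducible => // y; apply/negP => /eqP/(congr1 th).
    rewrite rmorphM rmorphXn rmorphN rmorphM !thC thv => /eqP; exact/negP/h1.
  rewrite rmorphD !rmorphM !thC thv thX => /eqP; exact/negP/h2.
(* [pi2] is a quartic of the same shape with the same [u0]; only the leading coefficient and the
   additive constant change. *)
have -> : pi2 p c d hf = (4%:R * (proot p c)%:A)%:P * ('X ^+ 2 + u0%:P) ^+ 2 +
    (1 + 4%:R * ((proot p d)%:A * proot p u0))%:P.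
  rewrite /pi2 /pi1 -/u0 -mul_polyC !(polyCD, polyCM, polyC1, polyC_natr); ring.
apply: quartic_irreducible => [//||y|y]; first exact: mulf_neq0.
  apply/negP => /eqP/(congr1 th); rewrite rmorphN rmorphM th4 the rmorphXn => /eqP.
  exact/negP/h3.
apply/negP => /eqP/(congr1 th); rewrite rmorphD the !(rmorphM th (4%:R * _)) th4.
by rewrite !rmorphXn thX => /eqP; exact/negP/h4.
Qed.
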